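(* (i) For any positive integer $n$, the number $2^{\lceil\log_2 n\rceil}$ (the least power of two not smaller than $n$) is the least positive integer $m$ such that the numbers $k(k-1)/2$ $(k=1,\ldots,n)$ are pairwise distinct modulo $m$. (ii) Let $d\in\{2,3\}$ and $n\in\mathbb{Z}^+$, and let $m$ be the smallest positive integer such that $|\{k(dk-1)\bmod m:\ k=1,\ldots,n\}|=n$. Then $m=d^{\lceil\log_d n\rceil}$, the least power of $d$ not smaller than $n$. (iii) Let $n\in\{4,5,\ldots\}$ and let $m$ be the least positive integer such that the numbers $18k(3k-1)$ $(k=1,\ldots,n)$ are pairwise distinct modulo $m$. Then $m$ is the least prime $p>3n$ with $p\equiv 1\pmod 3$.
   Context: $\mathbb{Z}^+=\{1,2,3,\ldots\}$. *)

(* Defs.v *)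
From mathcomp Require Export all_boot.

Set Implicit Arguments.
Unset Strict Implicit.
Unset Printing Implicit Defensive.

Definition is_least (P : nat -> Prop) (m : nat) : Prop :=
  P m /\ forall m', P m' -> m <= m'.

(* k ranges over 1, ..., n, so k - 1 and d * k - 1 (d > 0) are never truncated. *)
Definition residues (f : nat -> nat) (n m : nat) : seq nat :=
  [seq f k %% m | k <- iota 1 n].

Definition distinct_mod (f : nat -> nat) (n m : nat) : bool :=
  uniq (residues f n m).

Definition nb_residues (f : nat -> nat) (n m : nat) : nat :=
  size (undup (residues f n m)).

Lemma nb_residuesE f n m : (nb_residues f n m == n) = distinct_mod f n m.
Proof.
have sz : size (residues f n m) = n by rewrite size_map size_iota.
rewrite /nb_residues /distinct_mod -[X in _ == X]sz.
apply/eqP/idP => [e|/undup_id -> //].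
by have := ltn_size_undup (residues f n m); rewrite e ltnn => /esym/negbFE.
Qed.

(* "The least positive m such that the f k (1 <= k <= n) are pairwise distinct
   modulo m" exists as soon as f is injective on the positive integers. *)
Lemma ex_least_modulus (f : nat -> nat) (n : nat) :
  {in [pred k | 0 < k] &, injective f} ->
  exists m, is_least (fun m => 0 < m /\ distinct_mod f n m) m.
Proof.
move=> f_inj.
have exP : exists m, (0 < m) && distinct_mod f n m.
  exists (\sum_(k <- iota 1 n) f k).+1; rewrite /= /distinct_mod map_inj_in_uniq ?iota_uniq //.
  have lt_f k : k \in iota 1 n -> f k < (\sum_(k <- iota 1 n) f k).+1.
    by move=> k_n; rewrite ltnS (big_rem k) //= leq_addr.
  move=> i j i_n j_n; rewrite !modn_small ?lt_f //.
  move: i_n j_n; rewrite !mem_iota => /andP[i0 _] /andP[j0 _].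
  exact: f_inj.
case: (ex_minnP exP) => m /andP[m0 mP] m_min; exists m; split=> // m' [m'0 m'P].
by apply: m_min; rewrite m'0.
Qed.

Lemma up_log_is_least d n :
  1 < d -> is_least (fun q => n <= q /\ exists e, q = d ^ e) (d ^ up_log d n).
Proof.
move=> d1; split; first by split; [exact: up_logP | exists (up_log d n)].
by move=> q [n_q [e q_e]]; rewrite q_e leq_exp2l // up_log_min // -q_e.
Qed.

(* Main.v *)
Require Import Defs.
From mathcomp Require Import all_boot zify.

(** If f k = k (d k - 1) and k = j + x, then f k - f j = x (d (2 j + x) - 1), so a
    modulus m fails for n as soon as m divides such a product with
    1 <= j < j + x <= n.  In parts (i) and (ii), if m = q d^b is at least n, smaller
    than the claimed power of d, and q > 1 is prime to d, then in (ii) a collision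
    is found with x = d^b by solving a linear congruence modulo q; in (i) the
    factors x and 2 j + x - 1 are taken to be q and 2^(b+1).

    Part (iii) needs a prime p = 1 mod 3 with 3n < p < 6n, for n > 1.  With N = 6n
    and Q_c the product of the k <= N congruent to c mod 3, consider
      Z = (6n)! n!^2 Q_1 / ((3n)!^2 (2n)! Q_2) = C(6n, 3n) Q_1 / (C(2n, n) Q_2),
    which is at least 16^n / (6n)^2.  Apart from prime powers p^e with e > 1, the
    only primes of positive exponent in Z are (up to p = 3) those with p = 1 mod 3
    and floor(N / p) = 1 mod 6, and that exponent is 2.  Without a prime
    p = 1 mod 3 in (3n, 6n) such p are at most N / 7, hence
      4^n <= (6n)^(1 + sqrt(6n)) 4^(6n / 7),
    which is false for large n; a chain of primes settles the other n.  Given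
    p < 6n, every m < p has a collision, by solving 3 (k + j) - 1 = c v for a
    suitable factor v of m and a small constant c. *)

Set Implicit Arguments.
Unset Strict Implicit.
Unset Printing Implicit Defensive.

(** * Collisions, linear congruences, and powers of [d] as moduli *)

Lemma distinct_modP f n m :
  reflect (forall j k, 0 < j < k -> k <= n -> f j <> f k %[mod m])
          (distinct_mod f n m).
Proof.
apply: (iffP idP) => [/(uniqP 0) inj j k /andP[j0 jk] kn e|inj].
  have := inj j.-1 k.-1; rewrite !inE size_map size_iota => /(_ ltac:(lia) ltac:(lia)).
  rewrite !(nth_map 0) ?size_iota ?nth_iota; [|lia..].
  rewrite !add1n !prednK; [|lia..].
  by move=> /(_ e); lia.
rewrite /distinct_mod map_inj_in_uniq ?iota_uniq // => j k.
rewrite !mem_iota => jn kn e.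
by case: (ltngtP j k) => // lt; [case: (inj j k) | case: (inj k j)] => //; lia.
Qed.

(** An inverse of [a] modulo [q] solves the congruence; a zero solution is replaced by [q] to keep
    [j] positive. *)
Lemma affine_root q a c : 0 < q -> coprime q a ->
  exists j, [/\ 0 < j, j <= q & q %| a * j + c].
Proof.
move=> q0 co.
have [u e]: exists u, a * u = 1 %[mod q].
  case: (posnP a) co => [->|a0 co].
    by rewrite /coprime gcdn0 => /eqP ->; exists 0; rewrite !modn1.
  have [u v e _] := egcdnP q a0; exists u; move: e.
  rewrite gcdnC (eqP co) mulnC => ->; by rewrite modnMDl.
pose i := (u * (c * q.-1)) %% q.
have qi : q %| a * i + c.
  rewrite /dvdn -modnDml modnMmr mulnA -modnMml e modnMml mul1n modnDml.
  by rewrite -mulnSr prednK // modnMl.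
case: (posnP i) => [i0|i0]; last by exists i; split=> //; exact/ltnW/ltn_pmod.
by exists q; split=> //; rewrite dvdn_addr ?dvdn_mull //; move: qi; rewrite i0 muln0.
Qed.

Lemma distinct_mod_leq f n m : 0 < m -> distinct_mod f n m -> n <= m.
Proof.
move=> m0 u; have := uniq_leq_size u (s2 := iota 0 m).
rewrite size_map !size_iota; apply=> _ /mapP[k _ ->].
by rewrite mem_iota /= ltn_pmod.
Qed.

Lemma eqn_mod_leq_dvd m a b : a <= b -> (a = b %[mod m]) <-> m %| b - a.
Proof.
by move=> ab; rewrite -eqn_mod_dvd //; split=> [->|/eqP ->].
Qed.

(** A smaller modulus is at least [n], so for [n > 1] it lies strictly between consecutive powers of
    [d], and its part [q] prime to [d] exceeds 1. *)
Lemma least_expn_modulus d n (P : nat -> Prop) : prime d -> 0 < n ->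
  P (d ^ up_log d n) ->
  (forall m, 0 < m -> P m -> n <= m) ->
  (forall a b q, d ^ a < n -> n <= q * d ^ b -> q * d ^ b < d ^ a.+1 ->
     coprime d q -> 1 < q -> ~ P (q * d ^ b)) ->
  is_least (fun m => 0 < m /\ P m) (d ^ up_log d n).
Proof.
move=> pd n0 Pd Pn noP; have d1 := prime_gt1 pd.
split=> [|m [m0 Pm]]; first by rewrite expn_gt0 prime_gt0.
case: (leqP 2 n) => [n1|]; last by case: (n) n0 => [|[|k]] //; rewrite up_log1.
rewrite leqNgt; apply/negP=> mlt.
have ltn := up_log_gtn d1 n1; have := up_log_gt0 d n; rewrite n1 d1.
case: (up_log d n) mlt ltn => // a mlt /= ltn _.
have nm := Pn m m0 Pm.
have [q coq e] := pfactor_coprime pd m0; set b := logn d m in e.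
rewrite {}e in nm Pm mlt m0.
have q1 : 1 < q.
  case: (q) m0 nm mlt => [|[|k]] //.
  rewrite mul1n ltn_exp2l // => _ nb; rewrite ltnS => ba.
  by move: (leq_trans ltn nb); rewrite ltnNge leq_exp2l // ba.
exact: (noP a b q).
Qed.

(** * Differences of quadratic sequences *)

Lemma triangular_sub j x :
  (j + x) * (j + x - 1) = j * (j - 1) + x * (2 * j + x - 1).
Proof. nia. Qed.

(** Each k (k - 1) is even, so the halving is exact and can be traded for the modulus 2 m. *)
Lemma distinct_mod_triangularP n m :
  reflect (forall j x, 0 < j -> 0 < x -> j + x <= n ->
             ~ (2 * m %| x * (2 * j + x - 1)))
          (distinct_mod (fun k => (k * (k - 1)) %/ 2) n m).
Proof.
have main j x : 0 < j -> 0 < x ->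
    (j * (j - 1)) %/ 2 = ((j + x) * (j + x - 1)) %/ 2 %[mod m] <->
    2 * m %| x * (2 * j + x - 1).
  move=> j0 x0.
  have ev k : k * (k - 1) = 2 * ((k * (k - 1)) %/ 2).
    by rewrite [RHS]mulnC divnK // dvdn2 oddM; case: k => // k; rewrite subn1 /= andNb.
  have e := triangular_sub j x; rewrite (ev (j + x)) (ev j) in e.
  move: (_ %/ 2) ((j + x) * _ %/ 2) (x * (2 * j + x - 1)) e => B A C e.
  rewrite eqn_mod_leq_dvd; last lia.
  have -> : C = 2 * (A - B) by lia.
  by rewrite dvdn_pmul2l.
apply: (iffP (distinct_modP _ n m)) => h.
  by move=> j x j0 x0 jx /main h'; apply: (h j (j + x)); [lia..|exact: h'].
move=> j k /andP[j0 jk] kn e; apply: (h j (k - j)); try lia.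
by apply/main; rewrite ?subnKC //; lia.
Qed.

Lemma pow_mul_dvd_opposite_parity a x y : odd x != odd y ->
  2 ^ a %| x * y -> (2 ^ a %| x) || (2 ^ a %| y).
Proof.
move=> par; have co z : odd z -> coprime (2 ^ a) z by move=> z1; rewrite coprimeXl ?coprime2n.
case ox : (odd x) par => par.
  by rewrite Gauss_dvdr ?co // => ->; rewrite orbT.
by rewrite Gauss_dvdl ?co // => [->//|]; case: (odd y) par.
Qed.

Lemma least_modulus_triangular n : 0 < n ->
  is_least (fun m => 0 < m /\ distinct_mod (fun k => (k * (k - 1)) %/ 2) n m)
           (2 ^ up_log 2 n).
Proof.
move=> n0; apply: least_expn_modulus => //; last 2 first.
- by move=> m; exact: distinct_mod_leq.
- move=> a b q an nq qa; rewrite coprime2n => oq q1 /distinct_mod_triangularP h.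
  have q3 : 2 < q by lia.
  have [e ge2] : exists e, 2 ^ b.+1 = 2 * e /\ 0 < e.
    by exists (2 ^ b); rewrite -expnS expn_gt0.
  have be : 2 ^ b = e by move: ge2; rewrite expnS; lia.
  rewrite expnS in qa; rewrite be in nq qa h.
  (* This is (q - 2) (e - 1) >= 0. The smaller of q and 2 e becomes x, and j is read off from the
     other one. *)
  have bnd : q + 2 * e <= q * e + 2 by nia.
  have [ltq|leq] := ltnP q (2 * e).
    apply: (h (e - q./2) q); try lia.
    have -> : 2 * (e - q./2) + q - 1 = 2 * e by lia.
    by apply/dvdnP; exists 1; lia.
  apply: (h (q./2.+1 - e) (2 * e)); try lia.
  have -> : 2 * (q./2.+1 - e) + 2 * e - 1 = q by lia.
  by apply/dvdnP; exists 1; lia.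
apply/distinct_mod_triangularP=> j x j0 x0 jx; rewrite -expnS => dv.
have := @up_logP 2 n isT; move: dv; set a := up_log 2 n => dv na.
(* One factor is odd, so 2 ^ (a + 1) divides the other; but both are positive and below 2 n <= 2 ^
   (a + 1). *)
have par : odd x != odd (2 * j + x - 1) by lia.
have := pow_mul_dvd_opposite_parity par dv.
rewrite expnS; case/orP=> /dvdn_leq; lia.
Qed.

Lemma distinct_mod_quadraticP c d n m : 0 < d ->
  reflect (forall j x, 0 < j -> 0 < x -> j + x <= n ->
             ~ (m %| c * (x * (d * (2 * j + x) - 1))))
          (distinct_mod (fun k => c * (k * (d * k - 1))) n m).
Proof.
move=> d0.
have main j x : 0 < j -> 0 < x ->
    c * (j * (d * j - 1)) = c * ((j + x) * (d * (j + x) - 1)) %[mod m] <->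
    m %| c * (x * (d * (2 * j + x) - 1)).
  move=> j0 x0.
  have -> : (j + x) * (d * (j + x) - 1) =
            j * (d * j - 1) + x * (d * (2 * j + x) - 1) by nia.
  by rewrite mulnDr eqn_mod_leq_dvd ?leq_addr // addnC addnK.
apply: (iffP (distinct_modP _ n m)) => h.
  by move=> j x j0 x0 jx /main h'; apply: (h j (j + x)); [lia..|exact: h'].
move=> j k /andP[j0 jk] kn e; apply: (h j (k - j)); try lia.
by apply/main; rewrite ?subnKC //; lia.
Qed.

Lemma distinct_mod_quadratic1P d n m : 0 < d ->
  reflect (forall j x, 0 < j -> 0 < x -> j + x <= n ->
             ~ (m %| x * (d * (2 * j + x) - 1)))
          (distinct_mod (fun k => k * (d * k - 1)) n m).
Proof.
move=> d0; have -> : distinct_mod (fun k => k * (d * k - 1)) n m =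
                     distinct_mod (fun k => 1 * (k * (d * k - 1))) n m.
  by congr uniq; apply: eq_map => k; rewrite mul1n.
by apply: (iffP (distinct_mod_quadraticP 1 n m d0)) => h j x j0 x0 jx;
  have := h j x j0 x0 jx; rewrite mul1n.
Qed.

Lemma collision2 a b q n : 2 ^ a < n -> n <= q * 2 ^ b -> q * 2 ^ b < 2 ^ a.+1 ->
  odd q -> 1 < q ->
  exists j x, [/\ 0 < j, 0 < x, j + x <= n & q * 2 ^ b %| x * (2 * (2 * j + x) - 1)].
Proof.
move=> an nq qa oq q1; have q3 : 2 < q by lia.
rewrite expnS in qa.
case: b nq qa => [|b]; rewrite ?expn0 ?muln1 => nq qa.
  (* For b = 0 the factor 2 (2 j + x) - 1 is q itself, unless q = 3 is below its least value 5; then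
     it is 9. *)
  have [q5|q5] := ltnP q 5.
    have eq3 : q = 3 by lia.
    have n3 : 2 < n.
      by case: a an qa => [|[|a]] an qa; rewrite ?expn0 ?expn1 ?expnS in an qa *; lia.
    by exists 2, 1; rewrite eq3.
  exists 1, (q./2 - 1); split; try lia.
  by apply: dvdn_mull; have -> : 2 * (2 * 1 + (q./2 - 1)) - 1 = q by lia.
have [e eE e0] : exists2 e, 2 ^ b.+1 = 2 * e & 0 < e.
  by exists (2 ^ b); rewrite -?expnS ?expn_gt0.
rewrite {}eE in nq qa *.
have co : coprime q 4 by rewrite (_ : 4 = 2 ^ 2) // coprimeXr ?coprimen2.
have [j [j0 jq dv]] := affine_root (2 * (2 * e) - 1) (ltnW q1) co.
exists j, (2 * e); split; try lia.
  have : 2 * n >= q * (2 * e) + 3 by lia.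
  by have [e1|e1] := ltnP e 2; [have -> : e = 1 by lia|]; nia.
rewrite mulnC dvdn_mul //.
by have -> : 2 * (2 * j + 2 * e) - 1 = 4 * j + (2 * (2 * e) - 1) by lia.
Qed.

(** With s = 2 j + x the factor is 3 s - 1, which can be q if q = 2 mod 3 and 2 q if q = 1 mod 3.
    Since s >= 3, the cases q = 1, 2, 5 are treated apart. *)
Lemma collision_prime_to3 n q : 1 < n -> q %% 3 != 0 ->
  (q <= 3 * n) || (q %% 3 == 2) && (q <= 6 * n - 4) -> (q = 5 -> 3 < n) ->
  exists j x, [/\ 0 < j, 0 < x, j + x <= n & q %| 3 * (2 * j + x) - 1].
Proof.
move=> n1 q3 qn q5.
have [r1|r1] := eqVneq (q %% 3) 1.
  have [q1|q1] := ltnP q 4.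
    have -> : q = 1 by lia.
    by exists 1, 1; rewrite dvd1n; split; lia.
  exists (q %/ 3), 1; split; try lia.
  have -> : 3 * (2 * (q %/ 3) + 1) - 1 = 2 * q by lia.
  exact: dvdn_mull.
have [q8|q8] := ltnP q 8.
  have [eq|eq] : q = 2 \/ q = 5 by lia.
    by exists 1, 1; rewrite eq; split.
  by exists 3, 1; rewrite eq; split=> //; exact: q5.
pose s := q %/ 3; have qs : q = 3 * s + 2 by rewrite /s; lia.
exists s./2, (1 + odd s).
case: (boolP (odd s)) => os; split; try lia.
  by have -> : 3 * (2 * s./2 + 2) - 1 = q by lia.
by have -> : 3 * (2 * s./2 + 1) - 1 = q by lia.
Qed.

Lemma collision3 a b q n : 3 ^ a < n -> n <= q * 3 ^ b -> q * 3 ^ b < 3 ^ a.+1 ->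
  coprime 3 q -> 1 < q ->
  exists j x, [/\ 0 < j, 0 < x, j + x <= n & q * 3 ^ b %| x * (3 * (2 * j + x) - 1)].
Proof.
move=> an nq qa co q1.
have q3 : q %% 3 != 0 by move: co; rewrite prime_coprime.
have ba : 3 ^ b <= 3 ^ a.
  rewrite leq_exp2l // -ltnS -(@ltn_exp2l 3) //; apply: leq_ltn_trans qa.
  by rewrite leq_pmull // ltnW.
have a0 : 0 < 3 ^ a by rewrite expn_gt0.
rewrite expnS in qa.
have bnd : q * 3 ^ b + 4 <= 3 * n by lia.
case: b nq qa ba bnd => [|b]; rewrite ?expn0 ?muln1 => nq qa ba bnd.
  have [||||j [x [j0 x0 jx dv]]] := @collision_prime_to3 n q; try lia.
    move=> q5; case: a an qa {ba a0} => [|a] an qa; rewrite ?expn0 ?expnS in an qa; first lia.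
    have := expn_gt0 3 a; lia.
  by exists j, x; split=> //; apply: dvdn_mull.
have [e eE [e0 oe]] : exists2 e, 3 ^ b.+1 = 3 * e & 0 < e /\ odd e.
  by exists (3 ^ b); rewrite -?expnS ?expn_gt0 ?oddX ?orbT.
have e3 : e = 1 \/ 3 <= e by lia.
rewrite {}eE in nq qa ba bnd *.
(* For x = 3 e the other factor 6 j + 9 e - 1 is even, so if q = 2 h it suffices that h divides its
   half; an odd q is prime to 6. *)
have [[h qh]|oq] : (exists h, q = 2 * h) \/ odd q.
- by case: (boolP (odd q)) => oq; [right|left; exists q./2; lia].
- subst q.
  have h0 : 0 < h by lia.
  have coh : coprime h 3 by rewrite coprime_sym prime_coprime // /dvdn; lia.
  have [j [j0 jq dv]] := affine_root (9 * e)./2 h0 coh.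
  exists j, (3 * e); split; try lia.
    have [h2|h2] := ltnP h 2; first lia.
    by nia.
  rewrite mulnC dvdn_mul //.
  have -> : 3 * (2 * j + 3 * e) - 1 = 2 * (3 * j + (9 * e)./2) by lia.
  by rewrite dvdn_pmul2l.
have q0 : 0 < q by lia.
have coq : coprime q 6.
  by rewrite (_ : 6 = 2 * 3) // coprimeMr coprimen2 oq coprime_sym.
have [j [j0 jq dv]] := affine_root (9 * e - 1) q0 coq.
have jlt : j + 3 * e <= n.
  case: e3 => e3; last first.
    have q5 : 4 < q by lia.
    have : 3 * q + 9 * e <= q * (3 * e) + 4 by move: e3 q5; clear; nia.
    lia.
  (* For e = 1 the bound leaves room for j < q only; j = q would make q divide 8. *)
  have [jlt|jge] := ltnP j q; first lia.
  have ej : j = q by lia.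
  have : q %| 2 ^ 3 by move: dv; rewrite e3 ej dvdn_addr // dvdn_mull.
  have /eqP : coprime q (2 ^ 3) by rewrite coprimeXr ?coprimen2.
  by move=> + /gcdn_idPl => ->; lia.
exists j, (3 * e); split; try lia.
rewrite mulnC dvdn_mul //.
by have -> : 3 * (2 * j + 3 * e) - 1 = 6 * j + (9 * e - 1) by lia.
Qed.

Lemma least_modulus_quadratic d n : d = 2 \/ d = 3 -> 0 < n ->
  is_least (fun m => 0 < m /\ distinct_mod (fun k => k * (d * k - 1)) n m)
           (d ^ up_log d n).
Proof.
move=> d23 n0; have pd : prime d by case: d23 => ->.
have d0 := prime_gt0 pd.
apply: least_expn_modulus => //; last 2 first.
- by move=> m; exact: distinct_mod_leq.
- move=> a b q an nq qa co q1 /(distinct_mod_quadratic1P _ _ d0) h.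
  have [j [x [j0 x0 jx]]] : exists j x, [/\ 0 < j, 0 < x, j + x <= n &
      q * d ^ b %| x * (d * (2 * j + x) - 1)].
    case: d23 => ed; subst d; last exact: (@collision3 a).
    by apply: (@collision2 a) => //; rewrite -coprime2n.
  exact: h.
apply/distinct_mod_quadratic1P => // j x j0 x0 jx.
(* The second factor is -1 modulo d, so the power of d would divide x, although 0 < x < n. *)
rewrite Gauss_dvdl; last first.
  rewrite coprimeXl // prime_coprime //; apply/negP => dv.
  have : d %| d * (2 * j + x) - (d * (2 * j + x) - 1) by rewrite dvdn_sub // dvdn_mulr.
  by rewrite subKn ?muln_gt0 ?d0 ?addn_gt0 ?x0 ?orbT // dvdn1; case: d23 => ->.
by move/(dvdn_leq x0); have := @up_logP d n (prime_gt1 pd); lia.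
Qed.

Lemma is_least_uniq P m m' : is_least P m -> is_least P m' -> m = m'.
Proof.
by move=> [Pm mP] [Pm' mP']; apply/eqP; rewrite eqn_leq mP // mP'.
Qed.

(** * Primes congruent to 1 modulo 3 between 3n and 6n *)

Lemma prod_primes_dvd a b X :
  (forall p, a <= p < b -> prime p -> p %| X) ->
  \prod_(a <= p < b | prime p) p %| X.
Proof.
elim: b => [|b IH] h; first by rewrite big_geq ?dvd1n.
have [ab|ab] := leqP a b; last by rewrite big_geq ?dvd1n.
rewrite big_mkcond big_nat_recr //= -big_mkcond /=.
have {}IH : \prod_(a <= p < b | prime p) p %| X by apply: IH => p pb; apply: h; lia.
case: ifP => pb; last by rewrite muln1.
rewrite Gauss_dvd ?IH ?h ?ab //=.
rewrite coprime_sym big_nat_cond.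
elim/big_ind: _ => [|m n co_m co_n|q /andP[/andP[_ qb] pq]].
- exact: coprimen1.
- by rewrite coprimeMr co_m.
by rewrite prime_coprime // dvdn_prime2 // gtn_eqF.
Qed.

Lemma sum_bin m : \sum_(i < m.+1) 'C(m, i) = 2 ^ m.
Proof.
by rewrite -[2]/(1 + 1) expnDn; apply: eq_bigr => i _; rewrite !exp1n !muln1.
Qed.

Lemma bin_odd_leq m : 'C(2 * m + 1, m) <= 4 ^ m.
Proof.
rewrite -(leq_pmul2l (isT : 0 < 2)) (_ : 2 * 4 ^ m = 2 ^ (2 * m + 1)); last first.
  by rewrite addn1 expnS expnM.
rewrite -sum_bin.
have lt1 : m < (2 * m + 1).+1 by lia.
have lt2 : m.+1 < (2 * m + 1).+1 by lia.
rewrite (bigD1 (Ordinal lt1)) //= (bigD1 (Ordinal lt2)) /=; last first.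
  by rewrite -val_eqE /= gtn_eqF.
rewrite -[X in _ <= _ + (X + _)]bin_sub; last lia.
have -> : 2 * m + 1 - m.+1 = m by lia.
lia.
Qed.

Lemma bin_central_leq n : 'C(2 * n, n) <= 4 ^ n.
Proof.
rewrite (_ : 4 = 2 ^ 2) // -expnM -sum_bin.
have lt1 : n < (2 * n).+1 by lia.
by rewrite (bigD1 (Ordinal lt1)) //= leq_addr.
Qed.

(** Induction through (k + 1) C(2k + 2, k + 1) = 2 (2k + 1) C(2k, k). *)
Lemma bin_central_geq n : 0 < n -> 4 ^ n <= 2 * n * 'C(2 * n, n).
Proof.
elim: n => // -[_ _|n IH _]; first by [].
have {}IH := IH isT; set k := n.+1 in IH *.
have e1 : 2 * k.+1 * 'C(2 * k + 1, k) = k.+1 * 'C(2 * k.+1, k.+1).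
  by rewrite (_ : 2 * k.+1 = (2 * k + 1).+1) ?mul_bin_diag //; lia.
have e2 : (2 * k + 1) * 'C(2 * k, k) = k.+1 * 'C(2 * k + 1, k).
  rewrite -(@bin_sub (2 * k + 1) k); last lia.
  have -> : 2 * k + 1 - k = k.+1 by lia.
  by rewrite addn1 mul_bin_diag.
rewrite expnS; lia.
Qed.

(** For n = 2 m + 1 the primes above m + 1 divide C(2 m + 1, m) <= 4 ^ m, and induction covers the
    others; an even n > 2 adds no prime. *)
Lemma primorial_leq n : \prod_(1 <= p < n.+1 | prime p) p <= 4 ^ n.
Proof.
elim/ltn_ind: n => n IH.
have [n3|n3] := ltnP n 3.
  by case: n n3 {IH} => [|[|[|]]] // _; rewrite unlock.
case: (boolP (odd n)) => on; last first.
  have n0 : 0 < n by lia.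
  rewrite big_mkcond big_nat_recr //= -big_mkcond /=.
  case: ifP => [pn|_]; first by have := even_prime pn; lia.
  rewrite muln1; have {1}-> : n = n.-1.+1 by lia.
  by apply: leq_trans (IH n.-1 _) _; [lia|rewrite leq_exp2l //; lia].
pose m := n./2; have nm : n = 2 * m + 1 by rewrite /m; lia.
rewrite (@big_cat_nat _ _ _ m.+2) /=; try lia.
have {2}-> : n = m.+1 + m by lia.
rewrite expnD leq_mul ?IH //; first lia.
apply: leq_trans (bin_odd_leq m); apply: dvdn_leq; first by rewrite bin_gt0; lia.
apply: prod_primes_dvd => p pb pp.
have : p %| n`! by rewrite dvdn_fact //; lia.
rewrite nm -(@bin_fact (2 * m + 1) m); last lia.
have nd k : k < p -> (p %| k`!) = false.
  elim: k => [|k IHk] kp; first by rewrite dvdn1; case: eqP pp => // ->.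
  by rewrite factS Euclid_dvdM // IHk ?(ltnW kp) // gtnNdvd.
by rewrite !Euclid_dvdM // !nd ?orbF //; lia.
Qed.

(** * Exponents of primes in factorials and in products over classes modulo 3 *)

Lemma sum_nat_widen m M (F : nat -> nat) : m <= M ->
  (forall e, m < e -> F e = 0) ->
  \sum_(1 <= e < m.+1) F e = \sum_(1 <= e < M.+1) F e.
Proof.
move=> mM F0; rewrite [RHS](@big_cat_nat _ _ _ m.+1) //=.
rewrite [X in _ = _ + X]big_nat_cond [X in _ = _ + X]big1 ?addn0 // => e /andP[/andP[me _] _].
exact: F0.
Qed.

(** A common range of [e] lets all exponents be compared term by term. *)
Lemma logn_fact_widen p n M : prime p -> n <= M ->
  logn p n`! = \sum_(1 <= e < M.+1) n %/ p ^ e.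
Proof.
move=> pp nM; rewrite logn_fact //; apply: sum_nat_widen => // e ne.
by rewrite divn_small //; apply: ltn_trans ne (ltn_expl _ (prime_gt1 pp)).
Qed.

Lemma logn_count_widen p k M : prime p -> 0 < k <= M ->
  logn p k = \sum_(1 <= e < M.+1) (p ^ e %| k).
Proof.
move=> pp /andP[k0 kM]; rewrite logn_count_dvd //.
have -> : k = k.-1.+1 by rewrite prednK.
rewrite (@sum_nat_widen k.-1 M) //; first lia.
move=> e ke; rewrite gtnNdvd //; apply: leq_ltn_trans (ltn_expl _ (prime_gt1 pp)); lia.
Qed.

Definition class_prod c N := \prod_(1 <= k < N.+1 | k %% 3 == c) k.

Lemma class_prod_gt0 c N : 0 < class_prod c N.
Proof.
by rewrite /class_prod big_nat_cond prodn_cond_gt0 // => k /andP[/andP[]].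
Qed.

Lemma class_prodS c N :
  class_prod c N.+1 = class_prod c N * (if N.+1 %% 3 == c then N.+1 else 1).
Proof. by rewrite /class_prod big_mkcond big_nat_recr //= -big_mkcond. Qed.

Definition class_mult c q N := \sum_(1 <= k < N.+1) ((q %| k) && (k %% 3 == c)).

Lemma logn_class_prod p c N : prime p ->
  logn p (class_prod c N) = \sum_(1 <= e < N.+1) class_mult c (p ^ e) N.
Proof.
move=> pp; rewrite /class_mult exchange_big /=.
have -> : logn p (class_prod c N) =
          \sum_(1 <= k < N.+1) (if k %% 3 == c then logn p k else 0).
  elim: N => [|N IH]; first by rewrite /class_prod !big_geq ?logn1.
  rewrite class_prodS lognM ?class_prod_gt0 //; last by case: ifP.
  by rewrite IH [RHS]big_nat_recr //=; case: ifP; rewrite ?logn1.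
rewrite !big_nat; apply: eq_bigr => k kN.
case: ifP => _; last by rewrite big1 // => e _; rewrite andbF.
by rewrite (@logn_count_widen p k N) //; apply: eq_bigr => e _; rewrite andbT.
Qed.

Lemma class_multS c q N :
  class_mult c q N.+1 = class_mult c q N + (q %| N.+1) && (N.+1 %% 3 == c).
Proof. by rewrite /class_mult big_nat_recr. Qed.

(* Multiples of q in the class c are the q * l with l in the class c / q. *)
Lemma class_multE q N : 0 < q ->
  (class_mult 1 q N, class_mult 2 q N) =
  match q %% 3 with
  | 0 => (0, 0)
  | 1 => ((N %/ q + 2) %/ 3, (N %/ q + 1) %/ 3)
  | _ => ((N %/ q + 1) %/ 3, (N %/ q + 2) %/ 3)
  end.
Proof.
move=> q0.
have q3 : q %% 3 = 0 \/ q %% 3 = 1 \/ q %% 3 = 2 by lia.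
elim: N => [|N IH].
  by rewrite /class_mult !big_geq // div0n; case: q3 => [|[]] ->.
rewrite !class_multS divnS //.
move: IH; case: (boolP (q %| N.+1)) => [/dvdnP[l e]|_] /=; last first.
  by rewrite !addn0 add0n.
have -> : N %/ q = l.-1.
  have := @divnS N q q0; rewrite e mulnK // dvdn_mull //; lia.
have l0 : 0 < l by lia.
have -> : (N.+1 %% 3) = ((l %% 3) * (q %% 3)) %% 3 by rewrite modnMm -e.
by case: q3 => [|[]] -> [-> ->]; congr (_, _); lia.
Qed.

Lemma dvdn_logn X Y : 0 < X -> 0 < Y ->
  (forall p, prime p -> p <= X -> logn p X <= logn p Y) -> X %| Y.
Proof.
move=> X0 Y0 h; apply/dvdn_partP=> // p; rewrite mem_primes => /and3P[pp _ pX].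
by rewrite p_part pfactor_dvdn // h // dvdn_leq.
Qed.

(* Let Q_c be [class_prod c N] with N = 6n.  Then 2 * [excess N (p ^ e)] bounds
   the contribution of p ^ e to the exponent of p in
   (6n)! n!^2 Q_1 / ((3n)!^2 (2n)! Q_2). *)
Definition excess N q := (N %/ q %% 6 == 1) && (q %% 3 != 2) : nat.

Definition excess_exp N p := \sum_(1 <= e < N.+1) excess N (p ^ e).

Definition excess_prod N := \prod_(1 <= p < N.+1 | prime p) p ^ excess_exp N p.

Lemma excess_prod_gt0 N : 0 < excess_prod N.
Proof. by apply: prodn_cond_gt0 => p pp; rewrite expn_gt0 prime_gt0. Qed.

Lemma excess_exp_leq_logn N p : prime p -> excess_exp N p <= logn p (excess_prod N).
Proof.
move=> pp; have [pN|Np] := leqP p N; last first.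
  rewrite /excess_exp big_nat big1 // => e /andP[e0 _].
  rewrite /excess divn_small //; apply: (leq_trans Np).
  by rewrite -{1}(expn1 p) leq_exp2l // prime_gt1.
rewrite -pfactor_dvdn ?excess_prod_gt0 // /excess_prod.
by rewrite (big_rem p) ?mem_index_iota ?prime_gt0 //= pp dvdn_mulr.
Qed.

(** With y = floor(6n / q), the factorials contribute 1 if y = 1 mod 6, -1 if y = 4 mod 6, and 0
    otherwise; the class products add 1, -1 or 0, for q = 1, 2, 0 mod 3, when y = 1 mod 3. The total
    is at most 2 [excess]. *)
Lemma excess_dvd n : 0 < n ->
  (6 * n)`! * n`! ^ 2 * class_prod 1 (6 * n) %|
  (3 * n)`! ^ 2 * (2 * n)`! * class_prod 2 (6 * n) * excess_prod (6 * n) ^ 2.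
Proof.
move=> n0; set N := 6 * n.
have gt0 := (class_prod_gt0, excess_prod_gt0, fact_gt0, muln_gt0, expn_gt0).
apply: dvdn_logn; rewrite ?gt0 // => p pp _.
rewrite !lognM ?gt0 //; have le := excess_exp_leq_logn N pp.
apply: leq_trans _ (leq_add (leqnn _) (leq_add le le)).
rewrite !(@logn_fact_widen p _ N) // /N; try lia.
rewrite !logn_class_prod // /excess_exp -!big_split /=.
apply: leq_sum => e _; set q := p ^ e.
have q0 : 0 < q by rewrite expn_gt0 prime_gt0.
have dv c k : 6 = c * k -> 0 < c -> k * n %/ q = (6 * n %/ q) %/ c.
  by move=> e6 c0; rewrite e6 -divnMA [q * c]mulnC -mulnA divnMl.
rewrite -{1}(mul1n n) (dv 2 3) // (dv 3 2) //.
have := dv 6 1 erefl isT; rewrite mul1n => ->.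
have := class_multE (6 * n) q0; rewrite /excess; move: (6 * n %/ q) => y.
have q3 : q %% 3 = 0 \/ q %% 3 = 1 \/ q %% 3 = 2 by lia.
by case: q3 => [|[]] -> [-> ->] /=; lia.
Qed.

(** The induction step is k (k + 2) <= (k + 3) (k + 1) with k = 3 (i + 1). *)
Lemma class_prod2_leq i :
  class_prod 2 (3 * i.+1) <= 3 * i.+1 * class_prod 1 (3 * i.+1).
Proof.
have step c k : 0 < c < 3 ->
    class_prod c (3 * k.+1) = class_prod c (3 * k) * (3 * k + c).
  move=> c3; rewrite (_ : 3 * k.+1 = (3 * k).+3); last lia.
  rewrite !class_prodS.
  have -> : (3 * k).+1 %% 3 = 1 by lia.
  have -> : (3 * k).+2 %% 3 = 2 by lia.
  have -> : (3 * k).+3 %% 3 = 0 by lia.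
  by case: c c3 => [|[|[|]]] //= _; rewrite !muln1 -?addnS ?addn0 -addn1 -?addnA.
elim: i => [|i IH].
  by rewrite !step // /class_prod !big_geq.
rewrite [X in X <= _]step // [X in _ <= _ * X]step //.
move: (class_prod 1 _) (class_prod 2 _) IH => A B; nia.
Qed.

Lemma excess_leq_fits N q : 0 < q -> excess N q <= (q <= N).
Proof.
move=> q0; rewrite /excess; have [//|Nq] := leqP q N; first by case: (_ && _).
by rewrite divn_small.
Qed.

(** Only the e with p ^ e <= N contribute, each at most 1. *)
Lemma expn_excess_leq N p : 0 < N -> prime p -> p ^ excess_exp N p <= N.
Proof.
move=> N0 pp; have p1 := prime_gt1 pp.
apply: leq_trans (trunc_logP p1 N0); rewrite leq_exp2l //.
set t := trunc_log p N.
suff le M : \sum_(1 <= e < M.+1) excess N (p ^ e) <= minn M t.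
  exact: leq_trans (le N) (geq_minr _ _).
elim: M => [|M IH]; first by rewrite big_geq.
rewrite big_nat_recr //=.
have := @excess_leq_fits N (p ^ M.+1); rewrite expn_gt0 prime_gt0 // => /(_ isT).
have : (p ^ M.+1 <= N) -> M.+1 <= t by exact: trunc_log_max.
by case: (p ^ M.+1 <= N) => [/(_ isT)|_] /=; lia.
Qed.

Lemma excess_exp_large N p : 0 < N -> prime p -> N < p ^ 2 ->
  excess_exp N p = excess N p.
Proof.
move=> N0 pp Np; rewrite /excess_exp big_ltn // expn1 big_nat big1 ?addn0 //.
move=> e /andP[e2 _]; rewrite /excess divn_small //.
by apply: leq_trans Np _; rewrite leq_exp2l // prime_gt1.
Qed.

(** Each p <= s contributes at most N. A larger p has exponent at most 1 and, if it occurs, is at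
    most N / 7; the primorial bound handles these. *)
Lemma excess_prod_leq n s : 0 < n -> s ^ 2 <= 6 * n < s.+1 ^ 2 ->
  (forall p, prime p -> 3 * n < p < 6 * n -> p %% 3 != 1) ->
  excess_prod (6 * n) <= (6 * n) ^ s * 4 ^ (6 * n %/ 7).
Proof.
move=> n0 /andP[sN Ns] nop; set N := 6 * n in sN Ns *.
have N0 : 0 < N by lia.
have sleN : s <= N by move: sN; rewrite -mulnn; nia.
have N7 : N %/ 7 <= N by exact: leq_div.
have -> : N ^ s = \prod_(1 <= p < N.+1 | p < s.+1) N.
  by rewrite -(@big_nat_widen _ _ _ 1 s.+1 N.+1 xpredT) // prod_nat_const_nat subn1.
apply: leq_trans (leq_mul (leqnn _) (primorial_leq (N %/ 7))).
rewrite (@big_nat_widen _ _ _ 1 (N %/ 7).+1 N.+1 prime) //.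
rewrite /excess_prod big_mkcond [X in _ <= X * _]big_mkcond [X in _ <= _ * X]big_mkcond.
rewrite -big_split /=; apply: leq_prod => p _.
have [pp|] := boolP (prime p); last by case: ifP; rewrite ?muln1 //= => _ ; lia.
rewrite ltnS ltnS /=; have [ps|sp] := leqP p s.
  apply: leq_trans (expn_excess_leq N0 pp) _; rewrite leq_pmulr //.
  by case: ifP => _ //; exact: prime_gt0.
have Np : N < p ^ 2 by apply: leq_trans Ns _; rewrite leq_exp2r.
rewrite excess_exp_large // mul1n /excess.
case: (boolP (_ && _)) => [/andP[y1 p3]|_]; last by case: ifP => _ //; exact: prime_gt0.
rewrite expn1 leq_divRL //.
case: ifP => // /negbT; rewrite -ltnNge => p7.
have p0 := prime_gt0 pp.
have y7 : N %/ p < 7 by rewrite ltn_divLR // mulnC.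
(* If p > N / 7, the quotient is below 7 and 1 mod 6, so N / 2 < p <= N; then p = 1 mod 3, which
   [nop] excludes. *)
have {y7} y1 : N %/ p = 1 by move: (N %/ p) y1 y7 => y; lia.
have := divn_eq N p; have := ltn_pmod N p0; rewrite y1 => lt e.
have np3 : p %% 3 != 0.
  by apply/negP=> /eqP/eqP; rewrite -/(dvdn 3 p) dvdn_prime2 // => /eqP; lia.
have : p < 6 * n.
  rewrite ltn_neqAle; apply/andP; split; last lia.
  by apply/eqP=> ep; move: np3; rewrite ep; lia.
by move=> p6; have := nop p pp; lia.
Qed.

Lemma central_ratio_leq n : 0 < n ->
  'C(6 * n, 3 * n) * class_prod 1 (6 * n) <=
  'C(2 * n, n) * class_prod 2 (6 * n) * excess_prod (6 * n) ^ 2.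
Proof.
move=> n0; have := excess_dvd n0.
have [le1 le2] : 3 * n <= 6 * n /\ n <= 2 * n by lia.
rewrite -(bin_fact le1) -(bin_fact le2).
have -> : 6 * n - 3 * n = 3 * n by lia.
have -> : 2 * n - n = n by lia.
set F := (3 * n)`!; set G := n`!.
have FG0 : 0 < F ^ 2 * G ^ 2 by rewrite muln_gt0 !expn_gt0 !fact_gt0.
set c6 := 'C(6 * n, _); set c2 := 'C(2 * n, _).
set q1 := class_prod 1 _; set q2 := class_prod 2 _; set w := excess_prod _.
have -> : c6 * (F * F) * G ^ 2 * q1 = F ^ 2 * G ^ 2 * (c6 * q1) by lia.
have -> : F ^ 2 * (c2 * (G * G)) * q2 * w ^ 2 = F ^ 2 * G ^ 2 * (c2 * q2 * w ^ 2) by lia.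
rewrite dvdn_pmul2l //; apply: dvdn_leq.
by rewrite !muln_gt0 bin_gt0 le2 class_prod_gt0 excess_prod_gt0.
Qed.

Lemma expn4_leq_excess n : 0 < n -> 4 ^ n <= 6 * n * excess_prod (6 * n).
Proof.
move=> n0; have n30 : 0 < 3 * n by lia.
have := central_ratio_leq n0; have := bin_central_leq n.
have := bin_central_geq n30; have := class_prod2_leq (2 * n).-1.
have -> : 3 * (2 * n).-1.+1 = 6 * n by lia.
have -> : 2 * (3 * n) = 6 * n by lia.
have := class_prod_gt0 1 (6 * n).
have -> : 4 ^ (3 * n) = 4 ^ n * (4 ^ n) ^ 2 by rewrite mulnC expnM.
have : 0 < 4 ^ n by rewrite expn_gt0.
move: (4 ^ n) (class_prod 1 _) (class_prod 2 _) ('C(6 * n, _)) ('C(2 * n, _)).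
move: (6 * n) (excess_prod _) => N w x q1 q2 c6 c2 x0 q10 h1 h2 h3 h4.
(* The claim is squared and multiplied by 4 ^ n and Q_1, to meet 4 ^ (3 n) <= 6 n C(6n, 3n). *)
rewrite -leq_sqr -(leq_pmul2l x0) -(leq_pmul2l q10) expnMn.
apply: (@leq_trans (q1 * (N * c6))); first by rewrite leq_pmul2l.
rewrite (_ : q1 * (N * c6) = N * (c6 * q1)); last lia.
apply: leq_trans (leq_mul (leqnn N) h4) _.
rewrite (_ : N * _ = N * w ^ 2 * (c2 * q2)); last lia.
rewrite (_ : q1 * _ = N * w ^ 2 * (x * (N * q1))); last lia.
by rewrite leq_mul // leq_mul.
Qed.

(** It fails at j = 8, whence the threshold 512 = 2 ^ 9 below. *)
Lemma expn2_gt_linear j : 9 <= j -> 42 * j.+1 + 3 <= 2 ^ j.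
Proof.
move=> j9; rewrite -(subnK j9); elim: (j - 9) => [|k IH] //.
by rewrite addSn expnS; lia.
Qed.

Lemma prime1mod3_large n : 512 ^ 2 <= 6 * n ->
  exists p, [/\ prime p, 3 * n < p < 6 * n & p %% 3 = 1].
Proof.
move=> big.
have n0 : 0 < n by case: (n) big.
have [] := boolP [exists p : 'I_(6 * n), [&& prime p, 3 * n < p & p %% 3 == 1]].
  move/existsP=> [p /and3P[pp pn /eqP p3]]; exists p; split=> //.
  by rewrite pn ltn_ord.
rewrite negb_exists => /forallP nop; exfalso.
have {}nop p : prime p -> 3 * n < p < 6 * n -> p %% 3 != 1.
  move=> pp /andP[pn p6]; have := nop (Ordinal p6).
  by rewrite /= pp pn.
have [s /andP[sN Ns]] : exists s, s ^ 2 <= 6 * n < s.+1 ^ 2.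
  have ex : exists s, s ^ 2 <= 6 * n by exists 0.
  have ub s : s ^ 2 <= 6 * n -> s <= 6 * n by rewrite -mulnn; nia.
  have [s le mx] := ex_maxnP ex ub.
  by exists s; rewrite le ltnNge; apply/negP=> /mx; rewrite ltnn.
have W := excess_prod_leq n0 (introT andP (conj sN Ns)) nop.
have := leq_trans (expn4_leq_excess n0) (leq_mul (leqnn _) W).
rewrite mulnA -expnS => {}W.
pose t := s.+1; pose j := trunc_log 2 t.
have t512 : 512 < t by rewrite -ltn_sqr; exact: leq_ltn_trans big Ns.
have j9 : 9 <= j by apply: trunc_log_max => //; exact: ltnW.
have /andP[jt tj] : 2 ^ j <= t < 2 ^ j.+1 by exact: trunc_log_bounds.
have : 2 ^ (2 * n) <= 2 ^ (2 * j.+1 * t + 2 * (6 * n %/ 7)).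
  rewrite expnD !(expnM 2 2); apply: leq_trans W _; rewrite leq_mul //.
  rewrite (expnM _ _ t) leq_exp2r // [2 * j.+1]mulnC expnM.
  by apply: leq_trans (ltnW Ns) _; rewrite leq_exp2r // ltnW.
rewrite leq_exp2l // => le.
have nt : n <= 7 * (j.+1 * t) by lia.
have := leq_trans (expn2_gt_linear j9) jt => jt'.
have : s ^ 2 <= 42 * j.+1 * t by lia.
(* Since 42 (j + 1) <= t - 3, this would give (t - 1) ^ 2 <= t (t - 3). *)
rewrite -mulnn; move: jt'; rewrite /t; move: (42 * j.+1) => c; nia.
Qed.

(** The first prime of the chain above x is less than twice its predecessor, which is at most x. *)
Lemma path_prime1mod3 a x ps :
  path (fun a b => [&& prime b, b %% 3 == 1 & b < 2 * a]) a ps ->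
  a <= x < last a ps ->
  exists p, [/\ prime p, x < p < 2 * x & p %% 3 = 1].
Proof.
elim: ps a => [|b ps IH] a /=; first by lia.
case/andP=> /and3P[pb /eqP b3 ba] pth /andP[ax xl].
have [bx|xb] := leqP b x; first by apply: IH pth _; rewrite bx.
by exists b; split=> //; lia.
Qed.

Lemma prime1mod3_between n : 1 < n ->
  exists p, [/\ prime p, 3 * n < p < 6 * n & p %% 3 = 1].
Proof.
move=> n1; have [/prime1mod3_large //|small] := leqP (512 ^ 2) (6 * n).
(* The chain starts from 6, the least 3 n, and passes 2 ^ 17 = 512 ^ 2 / 2. *)
pose ps := [:: 7; 13; 19; 37; 73; 139; 277; 547; 1093; 2179; 4357; 8713; 17419;
               34819; 69499; 138967].
have -> : 6 * n = 2 * (3 * n) by lia.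
apply: (@path_prime1mod3 6 _ ps); first by vm_compute.
apply/andP; split; first lia.
have le : 2 ^ 17 <= last 6 ps by vm_compute.
apply: leq_trans _ le; rewrite -(ltn_pmul2l (isT : 0 < 2)).
apply: leq_trans _ (_ : 512 ^ 2 <= 2 * 2 ^ 17); last by vm_compute.
by have -> : 2 * (3 * n) = 6 * n by lia.
Qed.

(** * The sequence 18 k (3 k - 1) *)

Lemma distinct_mod_quadratic18P n m :
  reflect (forall j x, 0 < j -> 0 < x -> j + x <= n ->
             ~ (m %| 18 * (x * (3 * (2 * j + x) - 1))))
          (distinct_mod (fun k => 18 * k * (3 * k - 1)) n m).
Proof.
have -> : distinct_mod (fun k => 18 * k * (3 * k - 1)) n m =
          distinct_mod (fun k => 18 * (k * (3 * k - 1))) n m.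
  by congr uniq; apply: eq_map => k; rewrite mulnA.
exact: distinct_mod_quadraticP.
Qed.

(** The prime p exceeds x and the prime factors of 18, and 3 (2 j + x) - 1 < 2 p is 2 mod 3, so it
    is not p. *)
Lemma distinct_mod_prime1mod3 n p : 3 < n -> prime p -> 3 * n < p -> p %% 3 = 1 ->
  distinct_mod (fun k => 18 * k * (3 * k - 1)) n p.
Proof.
move=> n4 pp pn p3; apply/distinct_mod_quadratic18P=> j x j0 x0 jx.
rewrite (_ : 18 = 2 * (3 * 3)) // !Euclid_dvdM // orbb => /orP[/orP[]|/orP[]].
- by move/dvdn_leq; lia.
- by move/dvdn_leq; lia.
- by move/dvdn_leq; lia.
by case/dvdnP=> -[|[|t]] e; [lia|lia|nia].
Qed.

(* With [m = u * v], a collision is [k - j = u] and [3 * (k + j) - 1 = c * v]. *)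
Lemma collision_composite n u v : u <= v -> 1 < u -> u * v + 11 <= 6 * n ->
  (u * v) %% 6 = 1 -> u * v != 49 ->
  exists j x, [/\ 0 < j, 0 < x, j + x <= n & u * v %| x * (3 * (2 * j + x) - 1)].
Proof.
move=> uv u1 bnd r ne49.
have main c : (c * v) %% 6 = 2 -> odd u -> 3 * u < c * v + 1 ->
    c * v + 1 + 3 * u <= u * v + 11 ->
  exists j x, [/\ 0 < j, 0 < x, j + x <= n & u * v %| x * (3 * (2 * j + x) - 1)].
  move=> r2 ou lo hi.
  exists ((c * v + 1 - 3 * u) %/ 6), u; split; try lia.
  rewrite dvdn_mul //.
  have -> : 3 * (2 * ((c * v + 1 - 3 * u) %/ 6) + u) - 1 = c * v by lia.
  exact: dvdn_mull.
have [[u5 v5]|[u7 v7]] : (u %% 6 = 5 /\ v %% 6 = 5) \/ (u %% 6 = 1 /\ v %% 6 = 1).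
- move: r; rewrite -modnMm.
  have := ltn_pmod u (isT : 0 < 6); have := ltn_pmod v (isT : 0 < 6).
  by move: (u %% 6) (v %% 6) => [|[|[|[|[|[|?]]]]]] [|[|[|[|[|[|?]]]]]] //; auto.
(* The constant c must make c v = 2 mod 6: c = 4 for v = 5 mod 6, and c = 2 or 8 for v = 1 mod 6,
   where 8 serves when 2 v is too small for j > 0. *)
- by apply: (main 4); lia.
have [u' v'] : 7 <= u /\ 7 <= v by lia.
have [lt|ge] := ltnP (3 * u) (2 * v + 1).
  by apply: (main 2); try lia; move: u' v'; clear; nia.
apply: (main 8); try lia.
have [u13|u13] := ltnP u 13; last by move: u13 uv; clear; nia.
have eu : u = 7 by lia.
have ev : v = 7 by lia.
by rewrite eu ev in ne49.
Qed.

Lemma modulus_ge_prime1mod3 n m p : 3 < n -> p < 6 * n ->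
  is_least (fun p => [/\ prime p, 3 * n < p & p = 1 %[mod 3]]) p ->
  0 < m -> distinct_mod (fun k => 18 * k * (3 * k - 1)) n m -> p <= m.
Proof.
move=> n4 p6 [[pp pn p3] pmin] m0 dm; rewrite leqNgt; apply/negP=> mp.
have nm := distinct_mod_leq m0 dm.
move/distinct_mod_quadratic18P: dm => nocol.
have p61 : p %% 6 = 1.
  have := even_prime pp; move: p3; rewrite (@modn_small 1) //; lia.
(* The constant 18 absorbs a divisor c of m, leaving a collision modulo m / c to be found. *)
have col c q : m = c * q -> c %| 18 ->
    (exists j x, [/\ 0 < j, 0 < x, j + x <= n & q %| x * (3 * (2 * j + x) - 1)]) -> False.
  move=> em c18 [j [x [j0 x0 jx dv]]]; apply: (nocol j x j0 x0 jx).
  by rewrite em dvdn_mul.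
have col' c q : m = c * q -> c %| 18 -> q %% 3 != 0 ->
    (q <= 3 * n) || (q %% 3 == 2) && (q <= 6 * n - 4) -> False.
  move=> em c18 q3 qn; apply: (col c q em c18).
  have [|||//|j [x [j0 x0 jx dv]]] := @collision_prime_to3 n q; try lia.
  by exists j, x; split=> //; apply: dvdn_mull.
have [m30|m30] := eqVneq (m %% 3) 0.
  have [m9|m9] := eqVneq (m %% 9) 0.
    apply: (col 9 (m %/ 9)) => //; first lia.
    by exists 1, (m %/ 9); split; try lia; rewrite dvdn_mulr.
  by apply: (col' 3 (m %/ 3)) => //; lia.
have m31 : m %% 3 = 1.
  have [//|m32] := eqVneq (m %% 3) 1.
  by case: (col' 1 m) => //; lia.
have mn : 3 * n < m.
  by rewrite ltnNge; apply/negP=> le; case: (col' 1 m) => //; lia.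
have om : odd m.
  by apply/negPn/negP=> em; case: (col' 2 m./2) => //; lia.
have npm : ~~ prime m.
  apply/negP=> pm; have := pmin m; rewrite m31.
  by move=> /(_ ltac:(by [])); lia.
(* 49 is an admissible modulus for n = 10, 11, 12, but p is smaller there. *)
have m49 : m != 49.
  apply/eqP=> e49; have [n12|n13] := ltnP n 13.
    by have := pmin 37; move=> /(_ ltac:(split=> //; lia)); lia.
  by apply: (nocol 6 7); rewrite ?e49.
have [u [v [e uv u1]]] : exists u v, [/\ m = u * v, u <= v & 1 < u].
  case/primePn: npm => [|[u /andP[u1 um] /dvdnP[v e]]]; first lia.
  have [vu|uv] := leqP v u; [exists v, u | exists u, v]; split; try nia.
apply: (col 1 (u * v)); rewrite ?mul1n //.
(* Both m and p are 1 mod 6, so m <= p - 6 <= 6 n - 11. *)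
by apply: collision_composite => //; rewrite -?e //; lia.
Qed.

Theorem theorem1p2 :
  (forall n : nat, 0 < n ->
     is_least
       (fun m => 0 < m /\ distinct_mod (fun k => (k * (k - 1)) %/ 2) n m)
       (2 ^ up_log 2 n))
  /\
  (forall d n m : nat, d = 2 \/ d = 3 -> 0 < n ->
     is_least
       (fun m' => 0 < m' /\ nb_residues (fun k => k * (d * k - 1)) n m' = n) m ->
     m = d ^ up_log d n)
  /\
  (forall n m : nat, 4 <= n ->
     is_least
       (fun m' => 0 < m' /\ distinct_mod (fun k => 18 * k * (3 * k - 1)) n m') m ->
     is_least (fun p => [/\ prime p, 3 * n < p & p = 1 %[mod 3]]) m).
Proof.
split; first exact: least_modulus_triangular.
split=> [d n m d23 n0 [[m0 mP] mmin]|n m n4 [[m0 mP] mmin]].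
  apply: is_least_uniq (least_modulus_quadratic d23 n0).
  split=> [|m' [m'0 m'P]]; first by rewrite -nb_residuesE mP.
  by apply: mmin; split=> //; apply/eqP; rewrite nb_residuesE.
have [p0 [pp0 /andP[p0n p06] p03]] := prime1mod3_between (ltnW (ltnW n4)).
have exP : exists p, [&& prime p, 3 * n < p & p %% 3 == 1].
  by exists p0; rewrite pp0 p0n p03.
have [p /and3P[pp pn /eqP p3] pmin] := ex_minnP exP.
have leastp : is_least (fun p => [/\ prime p, 3 * n < p & p = 1 %[mod 3]]) p.
  by split=> // q [pq qn q3]; apply: pmin; rewrite pq qn q3.
have p6 : p < 6 * n by apply: leq_ltn_trans p06; apply: pmin; rewrite pp0 p0n p03.
suff -> : m = p by [].
apply/eqP; rewrite eqn_leq (modulus_ge_prime1mod3 n4 p6 leastp) // andbT.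
by apply: mmin; rewrite prime_gt0 // distinct_mod_prime1mod3.
Qed.
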